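(* Let $0<s<1$. There exist constants $C,\sigma>0$ depending only on $s$ such that the following holds for every $R>0$. Suppose $u\ge\Psi$ on $B_R\cap\mathbb R^{++}$ satisfies $$\Delta u=-u^{-s}\ \text{ in } B_R\cap\mathbb R^{++},\qquad u(x_1,x_2)=0\ \text{ if } x_1=0\text{ or }x_2=0.$$ Then for every $x\in B_{R/2}\cap\mathbb R^{++}$, $$\frac{u}{\Psi}(x)-1\le C\,R^{-\frac{2}{1+s}}\left(\frac{|x|}{R}\right)^{\sigma}\max_{B_R\cap\mathbb R^{++}}u .$$
   Context: $\mathbb R^{++}=\{(x_1,x_2)\in\mathbb R^2: x_1>0,\ x_2>0\}$ and $B_R$ is the open disk of radius $R$ centered at the origin. Solutions $u$ are bounded, smooth in the interior and continuous up to the coordinate axes. $\Psi$ is the function, positive in $\mathbb R^{++}$, homogeneous of degree $\frac{2}{1+s}$, with $\Delta\Psi=-\Psi^{-s}$ in $\mathbb R^{++}$ and $\Psi=0$ on $\partial\mathbb R^{++}$. It is known that in polar coordinates on $\mathbb R^{++}$, $\frac1C r^{\frac{2}{s+1}}\sin(2\theta)<\Psi(r,\theta)<C r^{\frac{2}{s+1}}\sin(2\theta)$ with $C=C(s)$. *)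

(* Defs.v *)
From HB Require Import structures.
From mathcomp Require Import all_boot all_order all_algebra.
From mathcomp Require Import all_classical all_reals all_analysis.

Set Implicit Arguments.
Unset Strict Implicit.
Unset Printing Implicit Defensive.
Import Order.TTheory GRing.Theory Num.Theory.
Import numFieldNormedType.Exports.

Local Open Scope classical_set_scope.
Local Open Scope ring_scope.

Section Plane.
Context {R : realType}.
Implicit Types (f : R * R -> R) (A : set (R * R)) (x : R * R) (r s : R).

(* The library's norm on [R * R] is the sup norm. *)
Definition euclid x : R := Num.sqrt (x.1 ^+ 2 + x.2 ^+ 2).

Definition disk r : set (R * R) := [set x | euclid x < r].

Definition quadrant : set (R * R) := [set x | 0 < x.1 /\ 0 < x.2].

Definition closed_quadrant : set (R * R) := [set x | 0 <= x.1 /\ 0 <= x.2].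

Definition partial1 f : R * R -> R := 'D_((1, 0) : R * R) f.

Definition partial2 f : R * R -> R := 'D_((0, 1) : R * R) f.

Definition laplacian f x : R :=
  partial1 (partial1 f) x + partial2 (partial2 f) x.

(* [Cn n A f]: all partial derivatives of [f] of order at most [n] exist and
   are continuous on [A], which is meant to be open. *)
Fixpoint Cn (n : nat) A f : Prop :=
  (forall x, A x -> {for x, continuous f}) /\
  (if n is n'.+1 then
     [/\ forall x, A x -> derivable f x (1, 0) /\ derivable f x (0, 1),
         Cn n' A (partial1 f) & Cn n' A (partial2 f)]
   else True).

Definition smooth A f : Prop := forall n, Cn n A f.

(* [u] is bounded on the part of the disk of radius [r] in the open quadrant
   and vanishes on the axes; no continuity is required on the arc of radius
   [r]. *)
Definition is_solution s r (u : R * R -> R) : Prop :=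
  [/\ [bounded u x | x in disk r `&` quadrant],
      smooth (disk r `&` quadrant) u,
      {within disk r `&` closed_quadrant, continuous u},
      forall x, (disk r `&` quadrant) x -> laplacian u x = - (u x `^ (- s)) &
      forall x, (disk r `&` closed_quadrant) x -> x.1 = 0 \/ x.2 = 0 ->
        u x = 0].

Definition is_Psi s (Psi : R * R -> R) : Prop :=
  [/\ smooth quadrant Psi,
      {within closed_quadrant, continuous Psi},
      forall x, quadrant x -> 0 < Psi x,
      forall t x, 0 < t -> quadrant x -> Psi (t *: x) = t `^ (2 / (1 + s)) * Psi x &
      (forall x, quadrant x -> laplacian Psi x = - (Psi x `^ (- s))) /\
      (forall x, closed_quadrant x -> x.1 = 0 \/ x.2 = 0 -> Psi x = 0)].

End Plane.

(* Main.v *)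
(* Write [al = 2 / (1 + s)]. Since [Psi <= u], the difference [v = u - Psi]
   satisfies [laplacian v = Psi^-s - u^-s >= 0]: it is subharmonic, vanishes on
   the axes and is at most [M = sup u]. Comparison with explicit polynomial
   barriers gives [v <= 48 (M / r^2) x1 x2] on the square of side [r / 2].
   On the other hand [x1 x2 (1 - x1) (1 - x2)] is a subsolution of the equation
   of [Psi] on the unit square, which by homogeneity yields
   [Psi >= c |x|^(al - 2) x1 x2]. Dividing, [v / Psi] is at most a constant times
   [M r^-2 |x|^(2 - al) = M r^-al (|x| / r)^(2 - al)]. *)
Require Import Defs.
From mathcomp Require Import all_boot all_order all_algebra.
From mathcomp Require Import all_classical all_reals all_analysis.
From mathcomp Require Import ring lra.

Import Order.TTheory GRing.Theory Num.Theory.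
Import numFieldNormedType.Exports.
Local Open Scope classical_set_scope.
Local Open Scope ring_scope.

(** * Second derivatives along a line and touching parabolas *)

Section Touching.
Context {R : realType}.

(** The difference quotient of the restriction at [t] is the very difference quotient of [f] along
    [v], so only a directional derivative is involved and no chain rule. *)
Lemma is_derive_line {V W : normedModType R} (f : V -> W) (x v : V) (t : R)
    (df : W) :
  is_derive (t *: v + x) v f df ->
  is_derive t (1 : R) (fun t : R => f (t *: v + x)) df.
Proof.
move=> [dfx <-].
have E : (fun h : R => h^-1 *: (((fun t : R => f (t *: v + x)) \o shift t) (h *: 1)
            - f (t *: v + x)))
       = (fun h : R => h^-1 *: ((f \o shift (t *: v + x)) (h *: v) - f (t *: v + x))).
  apply/funext => h /=; rewrite [h *: 1]mulr1 scalerDl addrA.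
  by [].
by split; rewrite /derivable /derive E.
Qed.

(** Subtracting the parabola leaves [k] with a local maximum at [0], hence zero slope there. If
    [2 * c < h2], the slope [k1] would turn positive just to the right, and the mean value theorem
    would lift [k] above its maximum. *)
Lemma second_derivative_le (h h1 : R -> R) (h2 b c : R) :
  (\forall t \near (0 : R), is_derive t (1 : R) h (h1 t)) ->
  is_derive (0 : R) (1 : R) h1 h2 ->
  (\forall t \near (0 : R), h t <= h 0 + b * t + c * t ^+ 2) -> h2 <= 2 * c.
Proof.
move=> dh dh1 hle; rewrite leNgt; apply/negP => clt.
pose q := fun t : R => b * t + c * t ^+ 2.
pose k := fun t : R => h t - q t.
pose k1 := fun t : R => h1 t - (b + 2 * c * t).
have dk t : is_derive t (1 : R) h (h1 t) -> is_derive t 1 k (k1 t).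
  move=> dht; apply: is_derive_eq; rewrite /k1 /GRing.scale /=; ring.
have [e e0 He] : exists2 e : R, 0 < e & forall t : R, `|t| < e ->
    is_derive t (1 : R) h (h1 t) /\ h t <= h 0 + b * t + c * t ^+ 2.
  have /nbhs_norm0P[e /= e0 He] : \forall t \near (0 : R),
      is_derive t (1 : R) h (h1 t) /\ h t <= h 0 + b * t + c * t ^+ 2.
    exact: filterI dh hle.
  by exists e.
have k0 : k1 0 = 0.
  have [d0 _] := He 0 ltac:(by rewrite normr0).
  have := dk _ d0 => dk0.
  have : is_derive (0 : R) (1 : R) k 0.
    apply: (@derive1_at_max _ _ (- e) e); rewrite ?in_itv /=; try lra.
      move=> t; rewrite in_itv /= -ltr_norml => te.
      by have [/dk[]] := He _ te.
    move=> t; rewrite in_itv /= -ltr_norml => te.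
    have [_] := He _ te; rewrite /k /q; lra.
  by move=> d00; rewrite -(@derive_val _ _ _ _ _ _ _ dk0) (@derive_val _ _ _ _ _ _ _ d00).
have dk1 : is_derive (0 : R) (1 : R) k1 (h2 - 2 * c).
  apply: is_derive_eq; rewrite /GRing.scale /=; ring.
(* [k1] vanishes at [0], so its difference quotient is [k1 t / t]; the limit [h2 - 2 * c] is
   positive, which gives the sign of [k1] for small [t > 0]. *)
have [d d0 Hd] : exists2 d : R, 0 < d & forall t : R, 0 < t < d -> 0 < k1 t.
  have [ck1 vk1] := dk1.
  have /cvgr_gt := ck1; rewrite -/(derive k1 0 1) vk1.
  move=> /(_ 0); rewrite subr_gt0 => /(_ clt).
  rewrite /dnbhs /within /= => /nbhs_norm0P[d /= d0 Hd]; exists d => // t /andP[t0 td].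
  have := Hd t; rewrite /= gtr0_norm // => /(_ td).
  rewrite gt_eqF // => /(_ isT).
  by rewrite addr0 [t *: 1]mulr1 k0 subr0 /GRing.scale /= pmulr_rgt0 // invr_gt0.
pose m := Num.min (e / 2) (d / 2).
have m0 : 0 < m by rewrite lt_min !divr_gt0.
have me : m < e by rewrite gt_min; apply/orP; left; lra.
have md : m < d by rewrite gt_min; apply/orP; right; lra.
have H t : 0 <= t <= m -> is_derive t (1 : R) k (k1 t).
  move=> /andP[t0 tm]; apply: dk; apply: (He _ _).1.
  by rewrite ger0_norm // (le_lt_trans tm).
have [z] : exists2 z, z \in `]0, m[%R & k m - k 0 = k1 z * (m - 0).
  apply: MVT => //.
    by move=> t; rewrite in_itv /= => /andP[t0 tm]; apply: H; rewrite !ltW.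
  apply: derivable_within_continuous => t; rewrite in_itv /= => tm.
  by have [] := H t tm.
rewrite in_itv /= subr0 => /andP[z0 zm] E.
have := Hd z; rewrite z0 (lt_trans zm md) => /(_ isT) k1z.
have := mulr_gt0 k1z m0; rewrite -E /k /q.
have [_] := He m ltac:(by rewrite gtr0_norm).
lra.
Qed.

(** The first derivative is a witness [f1] rather than an iterated ['D]: sums and opposites then act
    on witnesses, with no identification of derivatives on a neighbourhood. *)
Definition second_derivative {V : normedModType R} (f : V -> R) (x v : V) (d : R) :=
  exists2 f1 : V -> R,
    \forall y \near x, is_derive y v f (f1 y) & is_derive x v f1 d.

Lemma second_derivativeB {V : normedModType R} (f g : V -> R) x v d e :
  second_derivative f x v d -> second_derivative g x v e ->
  second_derivative (f - g) x v (d - e).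
Proof.
move=> [f1 Hf df] [g1 Hg dg]; exists (f1 - g1); last exact: is_deriveB.
by near=> y; apply: is_deriveB; near: y.
Unshelve. all: by end_near. Qed.

Lemma second_derivativeN {V : normedModType R} (f : V -> R) x v d :
  second_derivative f x v d -> second_derivative (- f) x v (- d).
Proof.
move=> [f1 Hf df]; exists (- f1); last exact: is_deriveN.
by near=> y; apply: is_deriveN; near: y.
Unshelve. all: by end_near. Qed.

Definition touches_above {V : normedModType R} (f : V -> R) (x v : V) (b c : R) :=
  \forall t \near (0 : R), f (t *: v + x) <= f x + b * t + c * t ^+ 2.

Lemma second_derivative_touch {V : normedModType R} (f : V -> R) x v d b c :
  second_derivative f x v d -> touches_above f x v b c -> d <= 2 * c.
Proof.
move=> [f1 Hf df] fle.
apply: (@second_derivative_le (fun t => f (t *: v + x)) (fun t => f1 (t *: v + x))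
  d b c).
- have ct : (fun t : R => t *: v + x) @ (0 : R) --> x.
    rewrite -[X in _ --> X]add0r -(scale0r v).
    by apply: cvgD; [apply: cvgZr_tmp; exact: cvg_id|exact: cvg_cst].
  have := ct _ Hf; rewrite /= => H.
  by near=> t; apply: is_derive_line; near: t.
- by apply: is_derive_line; rewrite scale0r add0r.
- by near=> t; rewrite scale0r add0r; near: t.
Unshelve. all: by end_near. Qed.
End Touching.

(** * Comparison principle on rectangles *)

Section Box.
Context {R : realType}.
Implicit Types (f g v w : R * R -> R) (A : set (R * R)) (x : R * R).

Lemma Cn2_second_derivative A f x : open A -> A x -> Cn 2 A f ->
  second_derivative f x (1, 0) (partial1 (partial1 f) x) /\
  second_derivative f x (0, 1) (partial2 (partial2 f) x).
Proof.
move=> oA Ax [_ [df [_ [d1 _ _]] [_ [d2 _ _]]]].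
split.
  exists (partial1 f); last by apply: derivableP; apply: (d1 _ Ax).1.
  apply: filterS (open_nbhs_nbhs (conj oA Ax)) => y Ay.
  by apply: derivableP; exact: (df y Ay).1.
exists (partial2 f); last by apply: derivableP; apply: (d2 _ Ax).2.
apply: filterS (open_nbhs_nbhs (conj oA Ax)) => y Ay.
by apply: derivableP; exact: (df y Ay).2.
Qed.

(* The inequality [L <= laplacian v] in the viscosity sense, tested only by
   functions that are quadratic along each axis. *)
Definition laplacian_ge v x (L : R) := forall b1 c1 b2 c2,
  touches_above v x (1, 0) b1 c1 -> touches_above v x (0, 1) b2 c2 ->
  L <= 2 * c1 + 2 * c2.

Lemma laplacian_ge_second_derivative v x d1 d2 :
  second_derivative v x (1, 0) d1 -> second_derivative v x (0, 1) d2 ->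
  laplacian_ge v x (d1 + d2).
Proof.
move=> h1 h2 b1 c1 b2 c2 t1 t2.
by apply: lerD; [exact: second_derivative_touch h1 t1|exact: second_derivative_touch t2].
Qed.

Lemma laplacian_geB A f g x : open A -> A x -> Cn 2 A f -> Cn 2 A g ->
  laplacian_ge (f - g) x (laplacian f x - laplacian g x).
Proof.
move=> oA Ax /(Cn2_second_derivative _ _ _ oA Ax)[f1 f2].
move=> /(Cn2_second_derivative _ _ _ oA Ax)[g1 g2].
rewrite /laplacian opprD addrACA.
by apply: laplacian_ge_second_derivative; apply: second_derivativeB.
Qed.

Lemma laplacian_geN A f x : open A -> A x -> Cn 2 A f ->
  laplacian_ge (- f) x (- laplacian f x).
Proof.
move=> oA Ax /(Cn2_second_derivative _ _ _ oA Ax)[f1 f2].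
rewrite /laplacian opprD.
by apply: laplacian_ge_second_derivative; apply: second_derivativeN.
Qed.

Definition box (a b c d : R) : set (R * R) := `[a, b] `*` `[c, d].

Lemma in_box a b c d x : box a b c d x <-> a <= x.1 <= b /\ c <= x.2 <= d.
Proof. by rewrite /box /setX /= !in_itv. Qed.

(** Maximum principle. The barrier [w] is quadratic in each variable separately, with coefficients
    depending on the base point, so at an interior maximum of [v - w] it is itself, up to a
    constant, a test function for [laplacian_ge]. The strict inequality is asked only where [w < v];
    the bound for [Psi] relies on this, since its equation is nonlinear. *)
Lemma box_comparison (a b c d : R) v w (B1 C1 B2 C2 : R * R -> R) :
  a <= b -> c <= d ->
  {within box a b c d, continuous v} -> continuous w ->
  (forall x t, w (t + x.1, x.2) = w x + B1 x * t + C1 x * t ^+ 2) ->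
  (forall x t, w (x.1, t + x.2) = w x + B2 x * t + C2 x * t ^+ 2) ->
  (forall x, a < x.1 < b -> c < x.2 < d -> w x < v x ->
     exists2 L, laplacian_ge v x L & 2 * C1 x + 2 * C2 x < L) ->
  (forall x, box a b c d x -> [\/ x.1 = a, x.1 = b, x.2 = c | x.2 = d] ->
     v x <= w x) ->
  forall x, box a b c d x -> v x <= w x.
Proof.
move=> ab cd cv cw w1 w2 Hint Hbd.
have cB : compact (box a b c d) by apply: compact_setX; exact: segment_compact.
have B0 : box a b c d !=set0 by exists (a, c); rewrite in_box /= !lexx ab cd.
have [z] : exists2 z, z \in box a b c d &
    forall t, t \in box a b c d -> (v - w) t <= (v - w) z.
  apply: compact_EVT_max => //; apply: within_continuousB => //.
  exact: continuous_subspaceT.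
rewrite inE => Bz zmax x Bx.
suff : v z <= w z.
  move: (zmax x); rewrite inE => /(_ Bx).
  rewrite -[(v - w) x]/(v x - w x) -[(v - w) z]/(v z - w z); lra.
rewrite leNgt; apply/negP => wv.
move: (Bz); rewrite in_box => -[/andP[az zb] /andP[cz zd]].
have {}az : a < z.1.
  rewrite lt_neqAle az andbT; apply/eqP => E.
  by move: wv; rewrite ltNge Hbd //; constructor 1.
have {}zb : z.1 < b.
  rewrite lt_neqAle zb andbT; apply/eqP => E.
  by move: wv; rewrite ltNge Hbd //; constructor 2.
have {}cz : c < z.2.
  rewrite lt_neqAle cz andbT; apply/eqP => E.
  by move: wv; rewrite ltNge Hbd //; constructor 3.
have {}zd : z.2 < d.
  rewrite lt_neqAle zd andbT; apply/eqP => E.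
  by move: wv; rewrite ltNge Hbd //; constructor 4.
have [||L HL] := Hint z _ _ wv; first by rewrite az.
  by rewrite cz.
rewrite ltNge => /negP; apply.
have small (p q y : R) : p < y -> y < q -> \forall t \near (0 : R), p <= t + y <= q.
  move=> py yq; apply/nbhs_norm0P; exists (Num.min (y - p) (q - y)).
    by rewrite /= lt_min !subr_gt0 py yq.
  by move=> t /=; rewrite lt_min !ltr_norml; lra.
(* Maximality at [z] says that [v] stays below [w + (v z - w z)], which along each axis is the
   parabola with coefficients [B1 z, C1 z] or [B2 z, C2 z]. *)
apply: (HL (B1 z) (C1 z) (B2 z) (C2 z)).
  apply: filterS (small _ _ _ az zb) => t tb.
  have -> : t *: ((1, 0) : R * R) + z = (t + z.1, z.2).
    rewrite [z in LHS]surjective_pairing; congr pair;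
  by rewrite /= /GRing.scale /= ?mulr1 ?mulr0 ?add0r.
  have Bt : box a b c d (t + z.1, z.2) by rewrite in_box /= tb; split=> //; lra.
  move: (zmax (t + z.1, z.2)); rewrite inE => /(_ Bt).
  rewrite -[(v - w) (_, _)]/(v _ - w _) -[(v - w) z]/(v z - w z) w1; lra.
apply: filterS (small _ _ _ cz zd) => t tb.
have -> : t *: ((0, 1) : R * R) + z = (z.1, t + z.2).
  rewrite [z in LHS]surjective_pairing; congr pair;
  by rewrite /= /GRing.scale /= ?mulr1 ?mulr0 ?add0r.
have Bt : box a b c d (z.1, t + z.2) by rewrite in_box /= tb; split=> //; lra.
move: (zmax (z.1, t + z.2)); rewrite inE => /(_ Bt).
rewrite -[(v - w) (_, _)]/(v _ - w _) -[(v - w) z]/(v z - w z) w2; lra.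
Qed.

Lemma continuous_euclid : continuous (@euclid R).
Proof.
move=> x; apply: (continuous_comp (f := fun x : R * R => x.1 * x.1 + x.2 * x.2)).
  by apply: cvgD; apply: cvgM; (exact: cvg_fst || exact: cvg_snd).
exact: sqrt_continuous.
Qed.

Lemma open_quadrant : open (@quadrant R).
Proof.
have -> : @quadrant R = fst @^-1` [set y | 0 < y] `&` snd @^-1` [set y | 0 < y].
  by [].
by apply: openI; apply: open_comp; try exact: open_gt; move=> x _; [apply: cvg_fst|apply: cvg_snd].
Qed.

Lemma open_disk (r : R) : open (disk r).
Proof.
apply: (@open_comp _ _ (@euclid R) [set y | y < r]); last exact: open_lt.
by move=> x _; exact: continuous_euclid.
Qed.
End Box.

(** * Upper bound for subharmonic functions vanishing on the axes *)

Section Estimates.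
Context {R : realType}.
Implicit Types (v Psi : R * R -> R) (x : R * R).

Lemma euclid_ge0 x : 0 <= euclid x.
Proof. exact: sqrtr_ge0. Qed.

Lemma sqr_euclid x : euclid x ^+ 2 = x.1 ^+ 2 + x.2 ^+ 2.
Proof. by rewrite sqr_sqrtr // addr_ge0 // sqr_ge0. Qed.

Lemma disk_coord (r a b : R) x : 0 < r -> 0 <= x.1 <= a -> 0 <= x.2 <= b ->
  a ^+ 2 + b ^+ 2 < r ^+ 2 -> disk r x.
Proof.
move=> r0 /andP[x1 x1a] /andP[x2 x2b] abr.
rewrite /disk /= -ltr_sqr ?nnegrE ?euclid_ge0 ?ltW // sqr_euclid.
apply: le_lt_trans abr; apply: lerD; rewrite ler_sqr ?nnegrE //; lra.
Qed.

Lemma coord_le_euclid x : x.1 <= euclid x /\ x.2 <= euclid x.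
Proof.
have := sqr_euclid x; have := euclid_ge0 x; split; nra.
Qed.

(* [m] stands for [M / r ^+ 2], which keeps the barriers free of division. *)
Definition subharmonic_zero_trace (r m : R) v :=
  [/\ {within disk r `&` closed_quadrant, continuous v},
      forall x, (disk r `&` quadrant) x -> laplacian_ge v x 0,
      forall x, (disk r `&` quadrant) x -> v x <= m * r ^+ 2 &
      forall x, (disk r `&` closed_quadrant) x ->
        x.1 = 0 \/ x.2 = 0 -> v x = 0].

Lemma subharmonic_le (r m : R) v x : 0 < m -> subharmonic_zero_trace r m v ->
  (disk r `&` closed_quadrant) x -> v x <= m * r ^+ 2.
Proof.
move=> m0 [_ _ vle v0] [dx [x1 x2]].
have mr : 0 <= m * r ^+ 2 by rewrite mulr_ge0 ?sqr_ge0 ?ltW.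
have [e1|n1] := eqVneq x.1 0; first by rewrite v0 //; left.
have [e2|n2] := eqVneq x.2 0; first by rewrite v0 //; right.
by apply: vle; split => //; split; rewrite lt_neqAle eq_sym ?n1 ?n2.
Qed.

(** Linear decay towards the horizontal axis on the segment [x.1 = r / 2]. It supplies the boundary
    values for the product barrier of [subharmonic_le_mul]. *)
Lemma subharmonic_edge1 (r m : R) v (y : R) : 0 < r -> 0 < m ->
  subharmonic_zero_trace r m v -> 0 <= y <= r / 2 ->
  v (r / 2, y) <= 12 * m * r * y.
Proof.
move=> r0 m0 Sv /andP[y0 yr]; have [cv lapv _ v0] := Sv.
have mr : 0 < m * r by exact: mulr_gt0.
have dsk (z : R * R) : 0 <= z.1 <= 3 / 4 * r -> 0 <= z.2 <= r / 2 -> disk r z.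
  by move=> z1 z2; apply: (disk_coord _ _ _ _ r0 z1 z2); move: (exprn_gt0 2 r0); lra.
(* Away from the axis the global bound suffices, because [12 * m * r * y] is at least
   [3 * m * r ^+ 2]. *)
have [yr4|/ltW yr4] := leP (r / 4) y.
  have : v (r / 2, y) <= m * r ^+ 2.
    by apply: (subharmonic_le _ _ _ _ m0 Sv); split; [apply: dsk => /=; lra|split => /=; lra].
  nra.
(* On the box [[r / 4, 3 r / 4] x [0, r / 4]] the square reaches [m * r ^+ 2] on the lateral sides
   and the second term does so on the top; the Laplacian is [32 m - 64 m < 0]. At [x.1 = r / 2] only
   [12 m r y - 32 m y^2] remains. *)
pose w := fun x : R * R =>
  16 * m * ((x.1 - r / 2) * (x.1 - r / 2) + x.2 * (3 / 4 * r - 2 * x.2)).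
suff : v (r / 2, y) <= w (r / 2, y) 
  by have := mulr_ge0 (ltW m0) (sqr_ge0 y); rewrite /w /=; lra.
apply: (@box_comparison _ (r / 4) (3 / 4 * r) 0 (r / 4) v w
  (fun x => 32 * m * (x.1 - r / 2)) (fun=> 16 * m)
  (fun x => 16 * m * (3 / 4 * r - 4 * x.2)) (fun=> - (32 * m))).
- lra.
- lra.
- apply: continuous_subspaceW cv => z /in_box[z1 z2].
  by split; [apply: dsk; lra|split; lra].
- move=> z; rewrite /w.
  apply: cvgM; first exact: cvg_cst.
  apply: cvgD; apply: cvgM.
  + by apply: cvgB; [exact: cvg_fst|exact: cvg_cst].
  + by apply: cvgB; [exact: cvg_fst|exact: cvg_cst].
  + exact: cvg_snd.
  + by apply: cvgB; [exact: cvg_cst|apply: cvgM; [exact: cvg_cst|exact: cvg_snd]].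
- by move=> z t; rewrite /w /=; ring.
- by move=> z t; rewrite /w /=; ring.
- move=> z z1 z2 _; exists 0; last by rewrite /=; lra.
  by apply: lapv; split; [apply: dsk; lra|split; lra].
- move=> z /in_box[z1 z2] bz.
  have vz : v z <= m * r ^+ 2.
    by apply: (subharmonic_le _ _ _ _ m0 Sv); split; [apply: dsk; lra|split; lra].
  have q0 : 0 <= m * (z.2 * (3 / 4 * r - 2 * z.2)).
    by apply: mulr_ge0; [exact: ltW|apply: mulr_ge0; lra].
  have s0 : 0 <= m * ((z.1 - r / 2) * (z.1 - r / 2)).
    by apply: mulr_ge0; [exact: ltW|exact: sqr_ge0].
  case: bz => E.
  + by apply: (le_trans vz); move: q0; rewrite /w E; lra.
  + by apply: (le_trans vz); move: q0; rewrite /w E; lra.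
  + rewrite v0; first by rewrite /w; lra.
      by split; [apply: dsk; lra|split; lra].
    by right.
  + by apply: (le_trans vz); move: s0; rewrite /w E; lra.
- by rewrite in_box /=; split; lra.
Qed.

(** Symmetry in the diagonal, by which one edge estimate yields the other. *)
Lemma subharmonic_zero_trace_swap (r m : R) v :
  subharmonic_zero_trace r m v ->
  subharmonic_zero_trace r m (fun x => v (x.2, x.1)).
Proof.
have sd x : disk r (x.2, x.1) = disk r x by rewrite /disk /euclid /= addrC.
have sq x : (disk r `&` quadrant) x -> (disk r `&` quadrant) (x.2, x.1).
  by move=> [dx [x1 x2]]; split; [rewrite sd|split].
have sc x : (disk r `&` closed_quadrant) x ->
    (disk r `&` closed_quadrant) (x.2, x.1).
  by move=> [dx [x1 x2]]; split; [rewrite sd|split].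
move=> [cv lapv vle v0]; split.
- have /subspace_continuousP cv' := cv; apply/subspace_continuousP => x Dx.
  have swap_cvg : (fun y : R * R => (y.2, y.1)) @ nbhs x --> (x.2, x.1).
    exact: (cvg_pair (G := nbhs x.2) (H := nbhs x.1)
      (cvg_snd (F := nbhs x.1)) (cvg_fst (G := nbhs x.2))).
  move=> B /(cv' _ (sc _ Dx)) /swap_cvg; rewrite /within /= !near_simpl /=.
  by apply: filterS => y By /sc /By.
(* A parabola test of the swapped function along one axis is, by conversion, a test of [v] along the
   other. *)
- move=> x /sq /lapv lapx b1 c1 b2 c2 t1 t2; rewrite addrC.
  by apply: lapx; [exact: t2|exact: t1].
- by move=> x /sq /vle.
- by move=> x /sc Dx ax; apply: v0 => //=; case: ax; [right|left].
Qed.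

Lemma subharmonic_edge2 (r m : R) v (y : R) : 0 < r -> 0 < m ->
  subharmonic_zero_trace r m v -> 0 <= y <= r / 2 ->
  v (y, r / 2) <= 12 * m * r * y.
Proof.
move=> r0 m0 /subharmonic_zero_trace_swap Sv.
exact: subharmonic_edge1 _ _ _ _ r0 m0 Sv.
Qed.

(** Both edge estimates bound [v] on the far sides of the square by a barrier comparable to
    [x.1 * x.2]; comparison carries the bound inside. *)
Lemma subharmonic_le_mul (r m : R) v x : 0 < r -> 0 < m ->
  subharmonic_zero_trace r m v -> box 0 (r / 2) 0 (r / 2) x ->
  v x <= 48 * m * (x.1 * x.2).
Proof.
move=> r0 m0 Sv Bx; have [cv lapv _ v0] := Sv.
have dsk (z : R * R) : 0 <= z.1 <= r / 2 -> 0 <= z.2 <= r / 2 -> disk r z.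
  by move=> z1 z2; apply: (disk_coord _ _ _ _ r0 z1 z2); move: (exprn_gt0 2 r0); lra.
(* The factor [r - x.1] makes the harmonic [x.1 * x.2] strictly superharmonic, as comparison
   requires. Its value [r / 2] on the side [x.1 = r / 2] fixes the constant: [48 / 4 = 12]. *)
pose w := fun x : R * R => (48 * m / r) * (x.1 * x.2 * (r - x.1)).
have mr : 0 < m / r by rewrite divr_gt0.
have mrE : m / r * r = m by rewrite divfK // gt_eqF.
suff : v x <= w x.
  move: Bx => /in_box[x1 x2] /le_trans; apply; rewrite /w.
  have : 0 <= m / r * (x.1 * x.1 * x.2).
    by rewrite mulr_ge0 ?(ltW mr) // mulr_ge0 ?mulr_ge0 //; lra.
  have : m / r * r * (x.1 * x.2) = m * (x.1 * x.2) by rewrite mrE.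
  lra.
apply: (@box_comparison _ 0 (r / 2) 0 (r / 2) v w
  (fun x => 48 * m / r * (x.2 * (r - 2 * x.1))) (fun x => - (48 * m / r * x.2))
  (fun x => 48 * m / r * (x.1 * (r - x.1))) (fun=> 0)) => //.
- lra.
- lra.
- apply: continuous_subspaceW cv => z /in_box[z1 z2].
  by split; [apply: dsk; lra|split; lra].
- move=> z; rewrite /w.
  apply: cvgM; first exact: cvg_cst.
  apply: cvgM; first by apply: cvgM; [exact: cvg_fst|exact: cvg_snd].
  by apply: cvgB; [exact: cvg_cst|exact: cvg_fst].
- by move=> z t; rewrite /w /=; ring.
- by move=> z t; rewrite /w /=; ring.
- move=> z z1 z2 _; exists 0.
    by apply: lapv; split; [apply: dsk; lra|split; lra].
  have : 0 < m / r * z.2 by apply: mulr_gt0 => //; lra.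
  rewrite /=; lra.
- move=> z /in_box[z1 z2] bz.
  have dz : (disk r `&` closed_quadrant) z.
    by split; [apply: dsk; lra|split; lra].
  case: bz => E.
  + by rewrite v0 //; [rewrite /w E; lra|left].
  + have := subharmonic_edge1 _ _ _ _ r0 m0 Sv z2; rewrite -{1}E -surjective_pairing => /le_trans; apply.
    have : m / r * r * r * z.2 = m * r * z.2 by rewrite mrE.
    rewrite /w E; lra.
  + by rewrite v0 //; [rewrite /w E; lra|right].
  (* On this side [w] equals [24 m z.1 (r - z.1)], and [r - z.1] is at least [r / 2]. *)
  + have := subharmonic_edge2 _ _ _ _ r0 m0 Sv z1; rewrite -{1}E -surjective_pairing => /le_trans; apply.
    have : m / r * r * z.1 * (r - z.1) = m * z.1 * (r - z.1) by rewrite mrE.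
    have : 0 <= m * z.1 * (r / 2 - z.1).
      by apply: mulr_ge0; [apply: mulr_ge0; [exact: ltW|]|]; lra.
    rewrite /w E; lra.
Qed.
End Estimates.

(** * Lower bound for [Psi] *)

Section Psi.
Context {R : realType}.
Implicit Types (Psi : R * R -> R) (x : R * R) (s : R).

Lemma Cn_subset n (A B : set (R * R)) f : A `<=` B -> Cn n B f -> Cn n A f.
Proof.
move=> AB; elim: n f => [|n IH] f /= [cf df]; split.
- by move=> x /AB /cf.
- by [].
- by move=> x /AB /cf.
by have [d d1 d2] := df; split; [move=> x /AB /d|exact: IH|exact: IH].
Qed.

(** Comparison is applied to the opposites. Where [Psi] lies below the polynomial it is less than
    [1], so [- laplacian Psi = Psi^-s] exceeds [1], while minus the Laplacian of the polynomial is
    at most [1]. *)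
Lemma Psi_ge_box s Psi x : 0 < s -> is_Psi s Psi -> box 0 1 0 1 x ->
  x.1 * x.2 * ((1 - x.1) * (1 - x.2)) <= Psi x.
Proof.
move=> s0 [sP cP Pgt0 _ [lapP P0]].
pose w := fun x : R * R => - (x.1 * x.2 * ((1 - x.1) * (1 - x.2))).
move=> Bx; suff : (- Psi) x <= w x by rewrite /w lerN2.
apply: (@box_comparison _ 0 1 0 1 (- Psi) w
  (fun x => - (1 - 2 * x.1) * (x.2 * (1 - x.2))) (fun x => x.2 * (1 - x.2))
  (fun x => - (1 - 2 * x.2) * (x.1 * (1 - x.1))) (fun x => x.1 * (1 - x.1))) => //.
- have cP1 : {within box 0 1 0 1, continuous Psi}.
    by apply: continuous_subspaceW cP => z /in_box[z1 z2]; split; lra.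
  by move=> z; apply: continuousN; exact: cP1.
- move=> z; apply: cvgN; apply: cvgM.
    by apply: cvgM; [exact: cvg_fst|exact: cvg_snd].
  by apply: cvgM; apply: cvgB; (exact: cvg_cst || exact: cvg_fst || exact: cvg_snd).
- by move=> z t; rewrite /w /=; ring.
- by move=> z t; rewrite /w /=; ring.
- move=> z /andP[z1 z1'] /andP[z2 z2']; rewrite /w -[(- Psi) z]/(- Psi z) ltrN2 => Pw.
  have Qz : quadrant z by [].
  have q1 : 0 <= (z.1 - 1 / 2) * (z.1 - 1 / 2) by exact: sqr_ge0.
  have q2 : 0 <= (z.2 - 1 / 2) * (z.2 - 1 / 2) by exact: sqr_ge0.
  exists (- laplacian Psi z).
    by apply: (laplacian_geN quadrant) => //; exact: open_quadrant.
  (* [q1] and [q2] bound each [y (1 - y)] by [1 / 4], so the barrier side is at most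
     [4 * (1 / 4)]. *)
  rewrite lapP // opprK; apply: (@le_lt_trans _ _ 1); first by rewrite /=; lra.
  have P1 : Psi z < 1.
    apply: (lt_le_trans Pw); rewrite -[leRHS]mulr1; apply: ler_pM; nra.
  rewrite powRN invf_gt1 ?powR_gt0 ?Pgt0 //.
  have p1 : (1 : R) `^ s = 1 by rewrite powR1.
  by rewrite -[ltRHS]p1 gt0_ltr_powR // nnegrE ?ler01 // ltW ?Pgt0.
- move=> z /in_box[/andP[z1 z1'] /andP[z2 z2']] bz.
  rewrite /w -[(- Psi) z]/(- Psi z) lerN2.
  have P_ge0 : 0 <= Psi z.
    have [e1|n1] := eqVneq z.1 0; first by rewrite P0 //; left.
    have [e2|n2] := eqVneq z.2 0; first by rewrite P0 //; right.
    by apply/ltW/Pgt0; split; rewrite lt_neqAle eq_sym ?n1 ?n2.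
  by case: bz => E; rewrite E; move: P_ge0; lra.
Qed.

(** This is [Psi >= |x|^(al - 2) x1 x2 / 16] with denominators cleared, where [al = 2 / (1 + s)]. *)
Lemma Psi_ge s Psi x : 0 < s -> is_Psi s Psi -> quadrant x ->
  x.1 * x.2 * euclid x `^ (2 / (1 + s)) <= 16 * euclid x ^+ 2 * Psi x.
Proof.
move=> s0 HP Qx; have [x1 x2] := Qx.
have [_ _ Pgt0 hP _] := HP.
have [xe1 xe2] := coord_le_euclid x.
have e0 : 0 < euclid x by exact: lt_le_trans xe1.
(* Homogeneity transports [Psi_ge_box] from the circle of radius [1 / 2]. *)
pose t := (2 * euclid x)^-1.
have t0 : 0 < t by rewrite invr_gt0 mulr_gt0.
have te : t * euclid x = 1 / 2 by rewrite /t invfM; field; rewrite gt_eqF.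
have tx1 : 0 < t * x.1 <= 1 / 2 by rewrite mulr_gt0 // -te ler_pM2l.
have tx2 : 0 < t * x.2 <= 1 / 2 by rewrite mulr_gt0 // -te ler_pM2l.
have := Psi_ge_box s Psi (t *: x) s0 HP.
rewrite in_box hP // -[(t *: x).1]/(t * x.1) -[(t *: x).2]/(t * x.2).
move=> /(_ ltac:(by split; lra)) Pge.
(* Both coordinates of [t *: x] are at most [1 / 2], so [(1 - t x1) (1 - t x2)] is at least
   [1 / 4]. *)
have {Pge} : (t * x.1) * (t * x.2) / 4 <= t `^ (2 / (1 + s)) * Psi x.
  apply: le_trans Pge; apply: ler_wpM2l; first by rewrite mulr_ge0; lra.
  nra.
have tp : 0 < t `^ (2 / (1 + s)) by exact: powR_gt0.
have : t `^ (2 / (1 + s)) * euclid x `^ (2 / (1 + s)) <= 1.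
  rewrite -powRM ?(ltW t0) ?(ltW e0) // te.
  have p1 : (1 : R) `^ (2 / (1 + s)) = 1 by rewrite powR1.
  by rewrite -[leRHS]p1; apply: ge0_ler_powR; rewrite ?nnegrE ?divr_ge0 //; lra.
move: (powR_ge0 (euclid x) (2 / (1 + s))).
move: tp; set T := t `^ _; set E := euclid x `^ _ => T0 E0 TE Hle.
(* Multiplying by [T * t ^+ 2] expresses the goal through [t *: x]; as its norm is [1 / 2], the
   constant [16] becomes the [4] of [Hle]. *)
rewrite -(ler_pM2l (exprn_gt0 2 t0)) -(ler_pM2l T0).
have -> : T * (t ^+ 2 * (16 * euclid x ^+ 2 * Psi x)) =
  16 * (t * euclid x) ^+ 2 * (T * Psi x) by ring.
rewrite te.
have : (T * E) * ((t * x.1) * (t * x.2)) <= (t * x.1) * (t * x.2).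
  by rewrite ler_piMl // mulr_ge0; lra.
lra.
Qed.
End Psi.

(** * Combination of the two bounds *)

Theorem theorem1p5 (R : realType) (s : R) (hs0 : 0 < s) (hs1 : s < 1) :
  exists C sigma : R, 0 < C /\ 0 < sigma /\
  forall Psi : R * R -> R, is_Psi s Psi ->
  forall (r : R) (u : R * R -> R), 0 < r -> is_solution s r u ->
    (forall x, (disk r `&` quadrant) x -> Psi x <= u x) ->
  forall x, (disk (r / 2) `&` quadrant) x ->
    u x / Psi x - 1 <=
      C * r `^ (- (2 / (1 + s))) * (euclid x / r) `^ sigma *
        sup (u @` (disk r `&` quadrant)).
Proof.
(* [768 = 48 * 16] multiplies the constants of [subharmonic_le_mul] and [Psi_ge]; the exponent is
   left over from [|x|^2 / |x|^al] and is positive because [s > 0]. *)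
exists 768, (2 - 2 / (1 + s)); split; first by rewrite ltr0n.
have al2 : 0 < 2 - 2 / (1 + s).
  by rewrite subr_gt0 ltr_pdivrMr; lra.
split=> // Psi HP r u r0 [bu su cu lapu u0] Pu x [dx Qx].
have [sP cP Pgt0 _ [lapP P0]] := HP.
have [xe1 xe2] := coord_le_euclid x; have [x1 x2] := Qx.
have e0 : 0 < euclid x by exact: lt_le_trans xe1.
rewrite /disk /= in dx.
have Dx : (disk r `&` quadrant) x by split => //; rewrite /disk /=; lra.
set M := sup _.
have uM z : (disk r `&` quadrant) z -> u z <= M.
  move=> Dz; apply: ub_le_sup; last by exists z.
  (* Boundedness provides a bound by every real strictly above [K], hence the choice [K + 1]. *)
  case: bu => K [_ /(_ (K + 1))]; rewrite ltrDl ltr01 => /(_ isT) HK.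
  by exists (K + 1) => _ [y Dy <-]; apply: le_trans (HK _ Dy); exact: ler_norm.
have M0 : 0 < M.
  by apply: lt_le_trans (uM _ Dx); apply: lt_le_trans (Pu _ Dx); exact: Pgt0.
pose m := M / r ^+ 2.
have m0 : 0 < m by rewrite divr_gt0 // exprn_gt0.
have Sv : subharmonic_zero_trace r m (u - Psi).
  split.
  - apply: within_continuousB => //; apply: continuous_subspaceW cP.
    by move=> z [].
  - move=> z Dz b1 c1 b2 c2 t1 t2.
    have oD : open (disk r `&` quadrant).
      by apply: openI; [exact: open_disk|exact: open_quadrant].
    have sPD : Cn 2 (disk r `&` quadrant) Psi by apply: Cn_subset (sP 2) => y [].
    apply: le_trans (laplacian_geB _ _ _ _ oD Dz (su 2) sPD _ _ _ _ t1 t2).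
    rewrite lapu // lapP; last by case: Dz.
    have Pz := Pgt0 z (proj2 Dz).
    have uz : 0 < u z by exact: lt_le_trans Pz (Pu z Dz).
    rewrite opprK addrC subr_ge0 !powRN lef_pV2 ?posrE ?powR_gt0 //.
    apply: ge0_ler_powR; rewrite ?nnegrE; try exact: ltW.
    exact: Pu.
  - move=> z Dz; rewrite /m divfK ?gt_eqF ?exprn_gt0 //.
    apply: le_trans (uM _ Dz); rewrite -[(u - Psi) z]/(u z - Psi z).
    by have := Pgt0 z (proj2 Dz); lra.
  - move=> z [dz Qz] axz.
    by rewrite -[(u - Psi) z]/(u z - Psi z) u0 // P0 // subrr.
have := subharmonic_le_mul _ _ _ x r0 m0 Sv.
rewrite in_box => /(_ ltac:(by split; lra)).
rewrite -[(u - Psi) x]/(u x - Psi x) => vle.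
have Px := Pgt0 x Qx.
have -> : u x / Psi x - 1 = (u x - Psi x) / Psi x by field; rewrite gt_eqF.
rewrite ler_pdivrMr //; apply: (le_trans vle).
have := Psi_ge s Psi x hs0 HP Qx; set al := 2 / (1 + s).
have eal : 0 < euclid x `^ al by exact: powR_gt0.
rewrite -ler_pdivlMr // => xle.
(* With [|x| = r q], the powers of [r] and [q] separate and the claim becomes [vle] followed by
   [xle]. *)
pose q := euclid x / r.
have q0 : 0 < q by rewrite divr_gt0.
have qE : q `^ (2 - al) = q ^+ 2 / q `^ al.
  rewrite powRB; first by rewrite -(powR_mulrn 2 (ltW q0)).
  by apply/implyP => _; rewrite gt_eqF.
have eE : euclid x = r * q by rewrite /q mulrC divfK // gt_eqF.
have ealE : euclid x `^ al = r `^ al * q `^ al by rewrite eE powRM ?ltW.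
have ral : r `^ al != 0 by rewrite gt_eqF // powR_gt0.
have qal : q `^ al != 0 by rewrite gt_eqF // powR_gt0.
have -> : 768 * r `^ (- al) * (euclid x / r) `^ (2 - al) * M * Psi x
   = 48 * m * (16 * euclid x ^+ 2 * Psi x / euclid x `^ al).
  rewrite -/q qE ealE powRN /m eE.
  by field; rewrite ral qal gt_eqF.
by rewrite ler_pM2l // mulr_gt0.
Qed.
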